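(* Let $Q$ be an absolutely continuous stochastic algorithm with Hamiltonian $H$, and suppose that for all $k\in[n]$, $h\in\mathcal{H}$, $y,y'\in\mathcal{X}$ and $\mathbf{x}\in\mathcal{X}^n$ we have $D^k_{y,y'}H(h,\mathbf{x})\le c$ and $h(y)\in[0,b]$. For $h\in\mathcal{H}$ let $v(h)=\mathbb{E}[(h(X)-\mathbb{E}[h(X')])^2]$. Then for $\delta>0$, with probability at least $1-\delta$ in $\mathbf{X}\sim\mu^n$ and $h\sim Q_{\mathbf{X}}$, $$\Delta(h,\mathbf{X})\le 2\sqrt{v(h)\left(c^2+\frac{\ln(1/\delta)}{n}\right)}+b\left(c^2+\frac{\ln(1/\delta)}{n}\right).$$
   Context: $\mathcal{X}$ is a measurable space with probability measure $\mu$, $\mathbf{X}=(X_1,\dots,X_n)\sim\mu^n$, $X,X'\sim\mu$ independent. $\mathcal{H}$ is a measurable space of measurable functions $h:\mathcal{X}\to[0,\infty)$ with nonnegative a-priori measure $\pi$. A stochastic algorithm $Q:\mathbf{x}\mapsto Q_{\mathbf{x}}$ (probability measures on $\mathcal{H}$) is absolutely continuous if each $Q_{\mathbf{x}}$ and $\pi$ are mutually absolutely continuous. A measurable $H:\mathcal{H}\times\mathcal{X}^n\to\mathbb{R}$ is a Hamiltonian for $Q$ if $dQ_{\mathbf{x}}(h)=e^{H(h,\mathbf{x})}d\pi(h)/Z(\mathbf{x})$ with $Z(\mathbf{x})=\int_{\mathcal{H}}e^{H(h,\mathbf{x})}d\pi(h)$. Generalization gap: $\Delta(h,\mathbf{x})=\mathbb{E}[h(X)]-\frac1n\sum_{i=1}^n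 h(x_i)$. $S^k_y\mathbf{x}$ replaces the $k$-th coordinate of $\mathbf{x}$ by $y$; $D^k_{y,y'}G(h,\mathbf{x})=G(h,S^k_y\mathbf{x})-G(h,S^k_{y'}\mathbf{x})$. Probability ''in $\mathbf{X}\sim\mu^n$ and $h\sim Q_{\mathbf{X}}$'' is w.r.t. the joint law. All functions are assumed to have finite exponential moments of all orders. *)

(* Defs.v *)
From HB Require Import structures.
From mathcomp Require Import all_boot all_order all_algebra.
From mathcomp Require Import all_classical all_reals all_analysis.
Set Implicit Arguments. Unset Strict Implicit. Unset Printing Implicit Defensive.
Import Order.TTheory GRing.Theory Num.Theory.
Local Open Scope classical_set_scope.
Local Open Scope ring_scope.

Section defs.
Context {d : measure_display} {X : measurableType d} {R : realType}.

Definition replace_at (n : nat) (x : n.-tuple X) (k : 'I_n) (y : X) : n.-tuple X :=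
  [tuple if i == k then y else tnth x i | i < n].

(* Integral of a nonnegative function against the product measure mu^n on
   n.-tuple X, written out as the iterated integral (Tonelli):
   int_{mu^0} f = f [tuple],  int_{mu^(n+1)} f = int mu(dx) int_{mu^n} f(x :: t). *)
Fixpoint prod_integral (mu : {measure set X -> \bar R}) (n : nat) :
    (n.-tuple X -> \bar R) -> \bar R :=
  match n with
  | 0 => fun f => f [tuple]
  | n'.+1 => fun f => (\int[mu]_x prod_integral mu (fun t => f [tuple of x :: t]))%E
  end.

Definition hexpect (mu : {measure set X -> \bar R}) (f : X -> R) : R :=
  Rintegral mu setT f.

Definition gen_gap (mu : {measure set X -> \bar R}) (n : nat) (f : X -> R)
    (x : n.-tuple X) : R :=
  hexpect mu f - n%:R^-1 * \sum_(i < n) f (tnth x i).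

Definition hvariance (mu : {measure set X -> \bar R}) (f : X -> R) : R :=
  hexpect mu (fun x => (f x - hexpect mu f) ^+ 2).

Context {dH : measure_display} {Hs : measurableType dH}.

Definition partition_fun (pi : {measure set Hs -> \bar R}) (n : nat)
    (Ham : Hs -> n.-tuple X -> R) (x : n.-tuple X) : \bar R :=
  (\int[pi]_h (expR (Ham h x))%:E)%E.

Definition gibbs_density (pi : {measure set Hs -> \bar R}) (n : nat)
    (Ham : Hs -> n.-tuple X -> R) (x : n.-tuple X) (h : Hs) : \bar R :=
  (expR (Ham h x) / fine (partition_fun pi Ham x))%:E.

(* Probability of the event E in X ~ mu^n and h ~ Q_X (joint law):
   int mu^n(dx) Q_x({h | E h x}). *)
Definition joint_prob (mu : {measure set X -> \bar R})
    (pi : {measure set Hs -> \bar R}) (n : nat)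
    (Ham : Hs -> n.-tuple X -> R) (E : Hs -> n.-tuple X -> Prop) : \bar R :=
  prod_integral mu (fun x =>
    (\int[pi]_(h in [set h | E h x]) gibbs_density pi Ham x h)%E).

End defs.

(* Main.v *)
Require Import Defs.
From HB Require Import structures.
From mathcomp Require Import all_boot all_order all_algebra.
From mathcomp Require Import all_classical all_reals all_analysis.
From mathcomp Require Import measurable_realfun lra ring.
Import Order.TTheory GRing.Theory Num.Theory.
Import numFieldNormedType.Exports.
Local Open Scope classical_set_scope.
Local Open Scope ring_scope.

(* Write [p_x] for the density of [Q_x] and fix [h].  As a function of a single
   coordinate of [x], the weight [W x = p_x h] varies by a factor of at most
   [e^(2c)], because [e^H] and [Z] each vary by at most [e^c].  For such a [W]
   in one variable the Kantorovich inequality [E[W^2] <= cosh(c)^2 E[W]^2] and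
   Cauchy-Schwarz give [E[f W] <= cosh(c) sqrt(E[f^2]) E[W]], and this
   tensorizes over the coordinates when [f] is replaced by a product.  With
   [f = exp(lam (E[h] - h))], Bernstein's bound on [E[f^2]], [cosh c <= e^(c^2)]
   and Markov's inequality yield [E[1_bad W] <= delta E[W]].  Integrating over
   [h], with the integrals exchanged by Tonelli's theorem, proves the claim;
   the a-priori measure is sigma-finite because [Z] is finite. *)

(** * Elementary inequalities for the real exponential *)

Section exponential_inequalities.
Local Set Implicit Arguments.
Local Unset Strict Implicit.
Context {R : realType}.
Implicit Types s t c : R.

Lemma nondecreasing_of_derive (f df : R -> R) :
  (forall x : R, is_derive x 1 f (df x)) -> (forall x, 0 <= df x) ->
  {homo f : x y / x <= y}.
Proof.
move=> fdf df0 x y xy.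
have [|z _ fE] := @MVT_segment _ f df x y xy (fun z _ => fdf z).
  apply: derivable_within_continuous => z _.
  by have := fdf z => /@ex_derive.
by rewrite -subr_ge0 fE mulr_ge0// subr_ge0.
Qed.

(** The difference of the two sides vanishes at 0 and has derivative [1 - (1 - x) * expR x],
    nonnegative because [1 - x <= expR (- x)]. For [s < 2] this bounds [expR s] by its Pade
    approximant [(2 + s) / (2 - s)]. *)
Lemma expR_le_pade s : 0 <= s -> (2 - s) * expR s <= 2 + s.
Proof.
move=> s0.
pose f (x : R) : R := 2 + x - (2 - x) * expR x.
have fdf (x : R) : is_derive x 1 f (1 - (1 - x) * expR x).
  apply: is_derive_eq; rewrite /GRing.scale/=; ring.
have := fun df0 => nondecreasing_of_derive fdf df0 s0.
rewrite /f expR0 => h; rewrite -subr_ge0; apply: le_trans (h _); first by lra.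
move=> x; have := expR_ge1Dx (- x); rewrite -(ler_pM2r (expR_gt0 x)).
by rewrite -expRD addNr expR0 subr_ge0.
Qed.

Lemma expR_le_quadratic s : s <= 0 -> expR s <= 1 + s + s ^+ 2 / 2.
Proof.
move=> s0.
pose f (x : R) : R := expR x - (1 + x + x ^+ 2 / 2).
have fdf (x : R) : is_derive x 1 f (expR x - (1 + x)).
  apply: is_derive_eq; rewrite /GRing.scale/=; by field.
have := fun df0 => nondecreasing_of_derive fdf df0 s0.
rewrite /f expR0 => h; rewrite -subr_le0; apply: le_trans (h _) _; last by lra.
by move=> x; rewrite subr_ge0 expR_ge1Dx.
Qed.

(** For [s > 0] this is the Pade bound, since [(2 + s) / (2 - s) = 1 + s + s ^+ 2 / (2 - s)]; for
    [s <= 0] the coefficient 1/2 already suffices. Writing it with an upper bound [t] makes the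
    coefficient independent of [s], so that it can leave an expectation. *)
Lemma expR_le_bernstein s t : s <= t -> 0 <= t -> t < 2 ->
  expR s <= 1 + s + s ^+ 2 / (2 - t).
Proof.
move=> st t0 t2.
have [s0|s0] := leP s 0.
  apply: le_trans (expR_le_quadratic s0) _.
  rewrite lerD2l ler_wpM2l ?sqr_ge0// lef_pV2 ?posrE; lra.
have s2 : 0 < 2 - s by lra.
have : expR s <= 1 + s + s ^+ 2 / (2 - s).
  have -> : 1 + s + s ^+ 2 / (2 - s) = (2 + s) / (2 - s).
    by field; rewrite gt_eqF.
  by rewrite ler_pdivlMr// mulrC expR_le_pade// ltW.
move=> /le_trans; apply.
rewrite lerD2l ler_wpM2l ?sqr_ge0// lef_pV2 ?posrE; lra.
Qed.

Lemma expR_le_bernstein1 s : s <= 1 -> expR s <= 1 + s + s ^+ 2.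
Proof.
move=> s1; have := @expR_le_bernstein s 1 s1 ler01 (ltr1n R 2).
have -> : 2 - 1 = 1 :> R by lra.
by rewrite divr1.
Qed.

(** Covers the endpoint [s = 2], where the coefficient of [expR_le_bernstein] diverges. The size of
    the constant 8 is immaterial: it will multiply a zero variance. *)
Lemma expR_le_bernstein2 s : s <= 2 -> expR s <= 1 + s + 8 * s ^+ 2.
Proof.
move=> s2; have [s1|s1] := leP s 1.
  have := expR_le_bernstein1 s1.
  have := sqr_ge0 s; lra.
(* The Pade bound at 1 reads [expR 1 <= 3]; hence [expR s <= 9] up to 2, while the right-hand side
   exceeds 10 for [s > 1]. *)
have e1 : expR 1 <= 3 :> R by have := expR_le_pade ler01; lra.
have e2 : expR s <= 9.
  rewrite (le_trans (_ : _ <= expR 2))// ?ler_expR//.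
  have -> : (2 : R) = 1 + 1 by lra.
  rewrite expRD; have := expR_gt0 (1 : R); nra.
nra.
Qed.

(** By symmetry [c >= 0]. Up to 1, averaging the quadratic bounds at [c] and [- c] gives
    [1 + c ^+ 2]; beyond 1, both exponentials are at most [expR c <= expR (c ^+ 2)]. *)
Lemma cosh_le_expR_sqr c : (expR c + expR (- c)) / 2 <= expR (c ^+ 2).
Proof.
wlog c0 : c / 0 <= c => [h|].
  have [|/ltW c0] := leP 0 c; first exact: h.
  by have := h (- c); rewrite oppr_ge0 opprK sqrrN addrC; exact.
have [c1|c1] := leP c 1.
  have := expR_le_bernstein1 c1.
  have := @expR_le_bernstein1 (- c) ltac:(lra).
  have := expR_ge1Dx (c ^+ 2); rewrite sqrrN; lra.
have : expR c <= expR (c ^+ 2) by rewrite ler_expR; nra.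
have : expR (- c) <= expR c by rewrite ler_expR; lra.
lra.
Qed.

End exponential_inequalities.

(** * Moment and ratio bounds in a single coordinate *)

Section one_coordinate.
Local Set Implicit Arguments.
Local Unset Strict Implicit.
Context {d : measure_display} {X : measurableType d} {R : realType}.
Variable mu : probability X R.
Implicit Types f : X -> R.

Lemma probability_inhabited : exists x : X, True.
Proof.
apply: contrapT => nX.
have X0 : [set: X] = set0 by apply/seteqP; split => // x _; apply: nX; exists x.
have := probability_setT mu; rewrite X0 measure0 => /eqP.
by rewrite eq_sym onee_eq0.
Qed.

Lemma integral_probability_cst (r : \bar R) : (\int[mu]_x r = r)%E.
Proof. by rewrite integral_cst//= probability_setT mule1. Qed.

Lemma bounded_measurable_integrable f (M : R) :
  measurable_fun setT f -> (forall x, `|f x| <= M) ->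
  mu.-integrable setT (EFin \o f).
Proof.
move=> mf fM; apply: measurable_bounded_integrable => //.
  by apply: le_lt_trans (probability_le1 mu measurableT) _; rewrite ltry.
exists M; split; first exact: num_real.
by move=> y My x _; apply: le_trans (fM x) (ltW My).
Qed.

(** The quadratic bound is applied at [th * (m - f x)], which is at most [th * b] as [m <= b] and
    [f x >= 0]; the linear term has mean zero. [K] is left abstract to serve both the Bernstein
    coefficient and the crude constant 8. *)
Lemma mgf_le_variance f (b th K : R) : measurable_fun setT f ->
  (forall x, 0 <= f x <= b) -> 0 <= th ->
  (forall s, s <= th * b -> expR s <= 1 + s + K * s ^+ 2) ->
  (\int[mu]_x (expR (th * (hexpect mu f - f x)))%:E <=
    (1 + K * th ^+ 2 * hvariance mu f)%:E)%E.
Proof.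
move=> mf fb th0 hK.
set m := hexpect mu f.
have [x0 _] := probability_inhabited.
have b0 : 0 <= b by case/andP: (fb x0) => /le_trans; apply.
have If : mu.-integrable setT (EFin \o f).
  apply: (@bounded_measurable_integrable _ b) => // x.
  by case/andP: (fb x) => h ?; rewrite ger0_norm.
have Ic (r : R) : mu.-integrable setT (EFin \o cst r).
  by apply: (@bounded_measurable_integrable _ `|r|).
have R1 (r : R) : Rintegral mu setT (cst r) = r.
  by rewrite /Rintegral /cst integral_probability_cst.
have m0 : 0 <= m by apply: Rintegral_ge0 => x _; case/andP: (fb x).
have mb : m <= b.
  rewrite -(R1 b); apply: (le_Rintegral _ If (Ic b)) => // x _.
  by case/andP: (fb x).
have mfB : measurable_fun setT (fun x => m - f x).
  by apply: measurable_funB.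
have fBb x : `|m - f x| <= b.
  by rewrite ler_norml; case/andP: (fb x) => ? ?; apply/andP; split; lra.
have I1 : mu.-integrable setT (EFin \o (fun x => m - f x)).
  exact: (@bounded_measurable_integrable _ b).
have I2 : mu.-integrable setT (EFin \o (fun x => (f x - m) ^+ 2)).
  apply: (@bounded_measurable_integrable _ (b ^+ 2)).
    by apply: measurable_funX; apply: measurable_funB.
  by move=> x; rewrite normrX distrC lerXn2r ?nnegrE.
have mE : measurable_fun setT (fun x => expR (th * (m - f x))).
  by apply: measurableT_comp => //; apply: measurable_funM.
have IE : mu.-integrable setT (EFin \o (fun x => expR (th * (m - f x)))).
  apply: (@bounded_measurable_integrable _ (expR (th * b))) => // x.
  rewrite ger0_norm ?expR_ge0// ler_expR ler_wpM2l//.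
  by apply: le_trans (fBb x); exact: ler_norm.
have I1' : mu.-integrable setT (EFin \o (fun x => th * (m - f x))).
  apply: (@bounded_measurable_integrable _ (th * b)).
    exact: measurable_funM.
  by move=> x; rewrite normrM (ger0_norm th0) ler_wpM2l.
have I2' : mu.-integrable setT
    (EFin \o (fun x => K * th ^+ 2 * (f x - m) ^+ 2)).
  apply: (@bounded_measurable_integrable _ (`|K * th ^+ 2| * b ^+ 2)).
    by apply: measurable_funM => //; apply: measurable_funX;
      exact: measurable_funB.
  by move=> x; rewrite normrM ler_wpM2l// normrX distrC lerXn2r ?nnegrE.
have I01 : mu.-integrable setT (EFin \o (fun x => 1 + th * (m - f x))).
  exact: (integrableD measurableT (Ic 1) I1').
have I012 : mu.-integrable setT (EFin \o (fun x => 1 + th * (m - f x) +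
    K * th ^+ 2 * (f x - m) ^+ 2)).
  exact: (integrableD measurableT I01 I2').
rewrite -[leLHS]fineK; last exact: integrable_fin_num.
rewrite lee_fin.
have -> : 1 + K * th ^+ 2 * hvariance mu f = Rintegral mu setT
    (fun x => 1 + th * (m - f x) + K * th ^+ 2 * (f x - m) ^+ 2).
  rewrite (RintegralD _ I01 I2')// (RintegralD _ (Ic 1) I1')//.
  rewrite (RintegralZl _ _ I1)// (RintegralZl _ _ I2)//.
  rewrite (RintegralB _ (Ic m) If)//.
  by rewrite !R1 /hvariance -/m /hexpect subrr mulr0 addr0.
apply: le_Rintegral => // x _.
have -> : K * th ^+ 2 * (f x - m) ^+ 2 = K * (th * (m - f x)) ^+ 2 by ring.
apply: hK; rewrite ler_wpM2l//.
by apply: le_trans (fBb x); exact: ler_norm.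
Qed.

(** Cauchy-Schwarz and Kantorovich are fused into one pointwise inequality that is linear in
    [f ^+ 2] and [g], so that it can be integrated term by term. The Kantorovich factor is
    [(1 + k) / (2 * Num.sqrt k)], and [Num.sqrt S] bounds the second-moment norm of [f]. *)
Lemma integral_mul_le_of_ratio f (g : X -> \bar R) (k S : R) :
  measurable_fun setT f -> (forall x, 0 <= f x) ->
  measurable_fun setT g -> (forall x, 0 <= g x)%E ->
  0 < k -> (forall x y, g x <= k%:E * g y)%E ->
  0 < S -> (\int[mu]_x (f x ^+ 2)%:E <= S%:E)%E ->
  (\int[mu]_x ((f x)%:E * g x) <=
    ((1 + k) / 2 * Num.sqrt (S / k))%:E * \int[mu]_x g x)%E.
Proof.
move=> mf f0 mg g0 k0 gk S0 fS.
set K := _ * Num.sqrt _.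
have K0 : 0 < K by rewrite mulr_gt0 ?sqrtr_gt0 ?divr_gt0// addr_gt0.
have [x0 _] := probability_inhabited.
(* An infinite value of [g] at one point spreads to all points by the ratio bound, and the
   right-hand side is infinite. *)
have [gy|gfin] := pselect (g x0 = +oo%E).
  have -> : (\int[mu]_x g x)%E = +oo%E.
    under eq_integral => x _.
      have -> : g x = +oo%E.
        have := gk x0 x; rewrite gy leye_eq => /eqP.
        case: (g x) (g0 x) => [r _|//|//]; by rewrite -EFinM.
      over.
    by rewrite integral_probability_cst.
  by rewrite gt0_muley// leey.
have {}gfin x : g x \is a fin_num.
  rewrite ge0_fin_numE//; apply: le_lt_trans (gk x x0) _.
  have : g x0 \is a fin_num by rewrite ge0_fin_numE// ltey; apply/eqP.
  by move/fineK => <-; rewrite -EFinM ltry.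
pose r x := fine (g x).
have gE x : g x = (r x)%:E by rewrite /r fineK.
have {}mg : measurable_fun setT r by exact: measurableT_comp.
have {g0} r0 x : 0 <= r x by rewrite -lee_fin -gE.
have {gk} rk x y : r x <= k * r y by rewrite -lee_fin EFinM -!gE.
under eq_integral do rewrite gE -EFinM.
under [in leRHS]eq_integral do rewrite gE.
have [rx0|] := eqVneq (r x0) 0.
  have rE x : r x = 0.
    by apply/eqP; rewrite eq_le r0 andbT (le_trans (rk x x0))// rx0 mulr0.
  under eq_integral do rewrite rE mulr0.
  under [in leRHS]eq_integral do rewrite rE.
  by rewrite integral0 mule0.
move=> rx0'; have {rx0'} rx0 : 0 < r x0 by rewrite lt_def rx0' r0.
(* The ratio bound confines [r] to the interval from [m] to [k * m], with [m > 0] because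
   [r x0 > 0]. *)
pose m := inf (range r).
have mr x : m <= r x.
  by apply: ge_inf; [exists 0 => _ [y _ <-]|exists x].
have rm x : r x <= k * m.
  rewrite mulrC -ler_pdivrMr//; apply: lb_le_inf; first by exists (r x0), x0.
  by move=> _ [y _ <-]; rewrite ler_pdivrMr// mulrC.
have m0 : 0 < m by rewrite -(pmulr_rgt0 _ k0) (lt_le_trans rx0).
have Ir : mu.-integrable setT (EFin \o r).
  apply: (@bounded_measurable_integrable _ (k * m)) => // x.
  by rewrite ger0_norm.
pose w := Rintegral mu setT r.
have wE : (\int[mu]_x (r x)%:E)%E = w%:E.
  by rewrite /w /Rintegral fineK//; exact: integrable_fin_num.
have w0 : 0 < w.
  apply: (lt_le_trans m0); rewrite -lee_fin -wE.
  rewrite -[leLHS]integral_probability_cst.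
  apply: ge0_le_integral => //=.
  - by move=> x _; rewrite lee_fin ltW.
  - exact: measurableT_comp.
  - by move=> x _; rewrite lee_fin.
(* This weight minimizes [a * S / 2 + K ^+ 2 * w ^+ 2 / (2 * a * S)], the integrated bound at the
   worst [m]; the minimum is [K * w]. *)
pose a := K * w / S.
have a0 : 0 < a by rewrite divr_gt0// mulr_gt0.
have KE : K ^+ 2 = (1 + k) ^+ 2 * S / (4 * k).
  rewrite /K exprMn sqr_sqrtr; last by rewrite divr_ge0// ltW.
  by field; rewrite gt_eqF.
have pointwise x : f x * r x + k * m ^+ 2 / (2 * a) <=
    a / 2 * f x ^+ 2 + (1 + k) * m / (2 * a) * r x.
  (* AM-GM on [f r] and [(r - m) (k m - r) >= 0] *)
  have h1 : 0 <= (r x - m) * (k * m - r x) by rewrite mulr_ge0 ?subr_ge0.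
  have h2 : 0 <= (a * f x - r x) ^+ 2 by exact: sqr_ge0.
  rewrite -subr_ge0.
  have -> : a / 2 * f x ^+ 2 + (1 + k) * m / (2 * a) * r x -
      (f x * r x + k * m ^+ 2 / (2 * a)) =
      ((r x - m) * (k * m - r x) + (a * f x - r x) ^+ 2) / (2 * a).
    by field; rewrite gt_eqF.
  by rewrite divr_ge0 ?addr_ge0// mulr_ge0// ltW.
have a2 : 0 <= 2 * a by rewrite mulr_ge0// ltW.
have k1 : 0 <= 1 + k by rewrite addr_ge0// ltW.
have C1 : 0 <= k * m ^+ 2 / (2 * a).
  by rewrite divr_ge0// mulr_ge0 ?sqr_ge0// ltW.
have C2 : 0 <= a / 2 by rewrite divr_ge0// ltW.
have C3 : 0 <= (1 + k) * m / (2 * a) by rewrite divr_ge0// mulr_ge0// ltW.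
have mfr : measurable_fun setT (fun x => f x * r x) by exact: measurable_funM.
have mf2 : measurable_fun setT (fun x => f x ^+ 2) by exact: measurable_funX.
have mf2E : measurable_fun setT (fun x => (f x ^+ 2)%:E).
  exact/measurable_EFinP.
have mrE : measurable_fun setT (fun x => (r x)%:E) by exact/measurable_EFinP.
have mfrE : measurable_fun setT (fun x => (f x * r x)%:E).
  exact/measurable_EFinP.
have f2E0 x : [set: X] x -> (0 <= (f x ^+ 2)%:E)%E by rewrite lee_fin sqr_ge0.
have rE0 x : [set: X] x -> (0 <= (r x)%:E)%E by rewrite lee_fin.
have frE0 x : [set: X] x -> (0 <= (f x * r x)%:E)%E by rewrite lee_fin mulr_ge0.
(* The constant stays on the left, so that all integrands are nonnegative and no integrability of
   [f * r] has to be known beforehand. *)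
have intineq : (\int[mu]_x (f x * r x)%:E + (k * m ^+ 2 / (2 * a))%:E <=
    (a / 2)%:E * S%:E + ((1 + k) * m / (2 * a))%:E * w%:E)%E.
  apply: (@le_trans _ _ (\int[mu]_x ((a / 2)%:E * (f x ^+ 2)%:E +
      ((1 + k) * m / (2 * a))%:E * (r x)%:E))%E); last first.
    rewrite ge0_integralD//.
    - by rewrite !ge0_integralZl_EFin// wE leeD2r// lee_wpmul2l.
    - by move=> x Xx; rewrite mule_ge0 ?f2E0.
    - exact: emeasurable_funM.
    - by move=> x Xx; rewrite mule_ge0 ?rE0.
    - exact: emeasurable_funM.
  rewrite -[X in (_ + X)%E]integral_probability_cst -ge0_integralD//.
  apply: ge0_le_integral => //.
  - by move=> x Xx; rewrite adde_ge0 ?frE0.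
  - exact: emeasurable_funD.
  - by apply: emeasurable_funD; exact: emeasurable_funM.
  - by move=> x _; rewrite -!EFinM -!EFinD lee_fin.
rewrite wE -EFinM; move: intineq.
rewrite -!EFinM -EFinD -leeBrDr// -EFinB => /le_trans; apply.
rewrite lee_fin -subr_ge0.
(* Completing the square in the unknown [m]; the remaining terms cancel by the choice of [a]. *)
have -> : K * w -
    (a / 2 * S + (1 + k) * m / (2 * a) * w - k * m ^+ 2 / (2 * a)) =
    (K * w / 2 - (1 + k) ^+ 2 * w ^+ 2 / (4 * k) / (2 * a)) +
    (m * (2 * k) - (1 + k) * w) ^+ 2 / (4 * k) / (2 * a).
  rewrite /a; field.
  by rewrite !gt_eqF.
have -> : K * w / 2 - (1 + k) ^+ 2 * w ^+ 2 / (4 * k) / (2 * a) = 0.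
  have -> : K * w / 2 = K ^+ 2 * w ^+ 2 / S / (2 * a).
    by rewrite /a; field; rewrite !gt_eqF.
  by rewrite KE; field; rewrite !gt_eqF.
by rewrite add0r !divr_ge0 ?sqr_ge0// mulr_ge0// ltW.
Qed.

End one_coordinate.

(** * Calculus of the iterated integral, and tensorization *)

Section prod_integral_theory.
Local Set Implicit Arguments.
Local Unset Strict Implicit.
Context {d : measure_display} {X : measurableType d} {R : realType}.
Variable mu : probability X R.
Local Open Scope ereal_scope.

Lemma prod_integral_ge0 n (F : n.-tuple X -> \bar R) :
  (forall x, 0 <= F x) -> 0 <= prod_integral mu F.
Proof.
elim: n F => [|n IH] F F0 //=.
by apply: integral_ge0 => x _; exact: IH.
Qed.

Lemma prod_integral_cst n (r : \bar R) :
  prod_integral mu (fun _ : n.-tuple X => r) = r.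
Proof.
elim: n => [//|n IH] /=.
by under eq_integral do rewrite IH; rewrite integral_probability_cst.
Qed.

(** The parameter space is generalized in the induction, because each step moves the head of the
    tuple into it, from [T] to [T * X]. *)
Lemma measurable_prod_integral n {dT : measure_display} {T : measurableType dT}
    (F : T * n.-tuple X -> \bar R) :
  measurable_fun setT F -> (forall p, 0 <= F p) ->
  measurable_fun setT (fun t => prod_integral mu (fun x => F (t, x))).
Proof.
elim: n dT T F => [|n IH] dT T F mF F0 /=.
  exact: (measurableT_comp mF (pair2_measurable _)).
pose G (q : (T * X) * n.-tuple X) := F (q.1.1, [tuple of q.1.2 :: q.2]).
have mG : measurable_fun setT G.
  apply: (measurableT_comp mF); apply: measurable_fun_pair => /=.
    exact: measurableT_comp.
  by apply: measurable_cons => //; exact: measurableT_comp.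
have := measurable_fun_fubini_tonelli_F (m2 := mu) _ (IH _ _ G mG (fun=> F0 _)).
by apply => q; apply: prod_integral_ge0 => t; exact: F0.
Qed.

Lemma measurable_prod_integral_cons n (F : n.+1.-tuple X -> \bar R) :
  measurable_fun setT F -> (forall x, 0 <= F x) ->
  measurable_fun setT
    (fun x => prod_integral mu (fun t => F [tuple of x :: t])).
Proof.
move=> mF F0.
pose G (q : X * n.-tuple X) := F [tuple of q.1 :: q.2].
apply: (@measurable_prod_integral _ _ _ G) => [|q]; last exact: F0.
by apply: (measurableT_comp mF); exact: measurable_cons.
Qed.

Lemma measurable_tuple_cons n (F : n.+1.-tuple X -> \bar R) (x : X) :
  measurable_fun setT F ->
  measurable_fun setT (fun t : n.-tuple X => F [tuple of x :: t]).
Proof.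
by move=> mF; apply: (measurableT_comp mF); exact: measurable_cons.
Qed.

Lemma le_prod_integral n (F G : n.-tuple X -> \bar R) :
  measurable_fun setT F -> measurable_fun setT G ->
  (forall x, 0 <= F x) -> (forall x, F x <= G x) ->
  prod_integral mu F <= prod_integral mu G.
Proof.
elim: n F G => [|n IH] F G mF mG F0 FG //=.
have G0 x : 0 <= G x by exact: le_trans (FG x).
apply: ge0_le_integral => //.
- by move=> x _; exact: prod_integral_ge0.
- exact: measurable_prod_integral_cons.
- exact: measurable_prod_integral_cons.
- by move=> x _; apply: IH => //; exact: measurable_tuple_cons.
Qed.

Lemma prod_integralD n (F G : n.-tuple X -> \bar R) :
  measurable_fun setT F -> measurable_fun setT G ->
  (forall x, 0 <= F x) -> (forall x, 0 <= G x) ->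
  prod_integral mu (fun x => F x + G x) =
  prod_integral mu F + prod_integral mu G.
Proof.
elim: n F G => [|n IH] F G mF mG F0 G0 //=.
rewrite -ge0_integralD//.
- by apply: eq_integral => x _; apply: (IH (fun t => F _) (fun t => G _)) => //;
    exact: measurable_tuple_cons.
- by move=> x _; exact: prod_integral_ge0.
- exact: measurable_prod_integral_cons.
- by move=> x _; exact: prod_integral_ge0.
- exact: measurable_prod_integral_cons.
Qed.

Lemma prod_integralZl n (F : n.-tuple X -> \bar R) (k : R) :
  measurable_fun setT F -> (forall x, 0 <= F x) -> (0 <= k)%R ->
  prod_integral mu (fun x => k%:E * F x) = k%:E * prod_integral mu F.
Proof.
elim: n F => [|n IH] F mF F0 k0 //=.
rewrite -ge0_integralZl_EFin//.
- by apply: eq_integral => x _; apply: (IH (fun t => F _)) => //;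
    exact: measurable_tuple_cons.
- by move=> x _; exact: prod_integral_ge0.
- exact: measurable_prod_integral_cons.
Qed.

(** With the head frozen, the induction hypothesis exchanges [nu] with the tail integral; Tonelli on
    [T * X] then exchanges it with the head, using joint measurability of the partial integral. *)
Lemma prod_integral_fubini n {dT : measure_display} {T : measurableType dT}
    (nu : {sigma_finite_measure set T -> \bar R})
    (F : T * n.-tuple X -> \bar R) :
  measurable_fun setT F -> (forall p, 0 <= F p) ->
  prod_integral mu (fun x => \int[nu]_t F (t, x)) =
  \int[nu]_t prod_integral mu (fun x => F (t, x)).
Proof.
elim: n F => [|n IH] F mF F0 //=.
pose G (q : (T * X) * n.-tuple X) := F (q.1.1, [tuple of q.1.2 :: q.2]).
have mG : measurable_fun setT G.
  apply: (measurableT_comp mF); apply: measurable_fun_pair => /=.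
    exact: measurableT_comp.
  by apply: measurable_cons => //; exact: measurableT_comp.
pose H (q : T * X) := prod_integral mu (fun t => G (q, t)).
have mH : measurable_fun setT H.
  by apply: measurable_prod_integral => // q; exact: F0.
have H0 q : 0 <= H q by apply: prod_integral_ge0 => t; exact: F0.
rewrite -[RHS]/(\int[nu]_t \int[mu]_x H (t, x)) (fubini_tonelli H)//.
apply: eq_integral => x _.
apply: (IH (fun q => F (q.1, [tuple of x :: q.2]))) => //.
apply: (measurableT_comp mF); apply: measurable_fun_pair => //=.
by apply: measurable_cons => //; exact: measurableT_comp.
Qed.

Lemma replace_at_head n (x y : X) (t : n.-tuple X) :
  replace_at [tuple of x :: t] ord0 y = [tuple of y :: t].
Proof.
apply: eq_from_tnth => i; rewrite tnth_mktuple.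
have [->//|] := eqVneq i ord0.
case: (unliftP ord0 i) => [j ->|->]; last by rewrite eqxx.
by rewrite !tnthS.
Qed.

Lemma replace_at_tail n (x y : X) (t : n.-tuple X) k :
  replace_at [tuple of x :: t] (lift ord0 k) y =
  [tuple of x :: replace_at t k y].
Proof.
apply: eq_from_tnth => i; rewrite tnth_mktuple.
case: (unliftP ord0 i) => [j ->|->].
  by rewrite !tnthS tnth_mktuple (inj_eq lift_inj).
by rewrite (negbTE (neq_lift _ _)) !tnth0.
Qed.

(* Tensorization of the one-coordinate bound: the partial integral of [W] over
   the last coordinates inherits the ratio bound in the first one. *)
Lemma prod_integral_mul_le_of_ratio n (f : X -> R) (W : n.-tuple X -> \bar R)
    (k S : R) :
  measurable_fun setT f -> (forall x, 0 <= f x)%R ->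
  measurable_fun setT W -> (forall x, 0 <= W x) ->
  (0 < k)%R ->
  (forall i x y y', W (replace_at x i y) <= k%:E * W (replace_at x i y')) ->
  (0 < S)%R -> \int[mu]_x (f x ^+ 2)%:E <= S%:E ->
  prod_integral mu (fun x => (\prod_(i < n) f (tnth x i))%:E * W x) <=
  (((1 + k) / 2 * Num.sqrt (S / k)) ^+ n)%:E * prod_integral mu W.
Proof.
move=> mf f0 mW W0 k0 + S0 fS.
set K := ((1 + k) / 2 * Num.sqrt (S / k))%R.
have K0 : (0 <= K)%R by rewrite mulr_ge0 ?sqrtr_ge0// divr_ge0// addr_ge0// ltW.
elim: n W mW W0 => [|n IH] W mW W0 Wk /=; first by rewrite big_ord0 expr0.
pose g x := prod_integral mu (fun t => W [tuple of x :: t]).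
have mg : measurable_fun setT g by exact: measurable_prod_integral_cons.
have g0 x : 0 <= g x by exact: prod_integral_ge0.
have gk x y : g x <= k%:E * g y.
  rewrite /g -prod_integralZl ?(ltW k0)//; last exact: measurable_tuple_cons.
  apply: le_prod_integral => //.
  - exact: measurable_tuple_cons.
  - by apply: emeasurable_funM => //; exact: measurable_tuple_cons.
  - move=> t; have := Wk ord0 [tuple of x :: t] x y.
    by rewrite !replace_at_head.
have mP m : measurable_fun setT
    (fun t : m.-tuple X => (\prod_(i < m) f (tnth t i))%:E).
  apply/measurable_EFinP; apply: measurable_prod => i _.
  by apply: (measurableT_comp mf); exact: measurable_tnth.
have P0 m (t : m.-tuple X) : (0 <= \prod_(i < m) f (tnth t i))%R.
  by apply: prodr_ge0.
(* With the head [x] frozen, [f x] leaves the tail integral and the induction hypothesis supplies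
   [K ^+ n]; the last factor [K] comes from the one-coordinate bound applied to [g]. *)
have step x : prod_integral mu (fun t => (\prod_(i < n.+1)
    f (tnth [tuple of x :: t] i))%:E * W [tuple of x :: t]) <=
    (K ^+ n)%:E * ((f x)%:E * g x).
  under [X in prod_integral _ X]eq_fun => t.
    rewrite big_ord_recl tnth0 (eq_bigr (fun i => f (tnth t i))); last first.
      by move=> i _; rewrite tnthS.
    rewrite EFinM -muleA; over.
  rewrite prod_integralZl//.
  - rewrite muleCA lee_wpmul2l ?lee_fin//; apply: IH => //.
      exact: measurable_tuple_cons.
    move=> i t y y'; have := Wk (lift ord0 i) [tuple of x :: t] y y'.
    by rewrite !replace_at_tail.
  - exact: (emeasurable_funM (mP n) (measurable_tuple_cons x mW)).
  - by move=> t; rewrite mule_ge0 ?lee_fin ?P0.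
have mfg : measurable_fun setT (fun x => (f x)%:E * g x).
  by apply: emeasurable_funM => //; exact/measurable_EFinP.
apply: (@le_trans _ _ (\int[mu]_x ((K ^+ n)%:E * ((f x)%:E * g x)))).
  apply: ge0_le_integral => //.
  - by move=> x _; apply: prod_integral_ge0 => t; rewrite mule_ge0 ?lee_fin ?P0.
  - apply: (@measurable_prod_integral_cons _ (fun x =>
      (\prod_(i < n.+1) f (tnth x i))%:E * W x)).
      exact: (emeasurable_funM (mP _) mW).
    by move=> t; rewrite mule_ge0 ?lee_fin ?P0.
  - exact: emeasurable_funM.
rewrite ge0_integralZl_EFin//.
- rewrite exprSr EFinM -muleA lee_wpmul2l ?lee_fin ?exprn_ge0//.
  exact: integral_mul_le_of_ratio.
- by move=> x _; rewrite mule_ge0// lee_fin.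
- by rewrite exprn_ge0.
Qed.

End prod_integral_theory.

(** * Tail bound for one fixed hypothesis *)

Section gibbs_tail.
Local Set Implicit Arguments.
Local Unset Strict Implicit.
Context {d : measure_display} {X : measurableType d} {R : realType}.
Variable mu : probability X R.
Implicit Types f : X -> R.

Lemma hvariance_ge0 f : 0 <= hvariance mu f.
Proof. by apply: Rintegral_ge0 => x _; exact: sqr_ge0. Qed.

(* For [v > 0] the optimal parameter is [lam = 1 / (b + sqrt (v / A))]; for
   [v = 0] it degenerates to [1 / b], where the Bernstein bound blows up but
   any quadratic bound on the exponential suffices. *)
Lemma bernstein_parameter f (b A : R) : measurable_fun setT f ->
  (forall x, 0 <= f x <= b) -> 0 < b -> 0 < A ->
  exists lam sig : R, [/\ 0 <= lam,
    (\int[mu]_x (expR (lam * (hexpect mu f - f x)) ^+ 2)%:E <=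
      (expR (2 * sig))%:E)%E &
    A + sig <= lam * (2 * Num.sqrt (hvariance mu f * A) + b * A)].
Proof.
move=> mf fb b0 A0; set v := hvariance mu f.
have sqE lam x : expR (lam * (hexpect mu f - f x)) ^+ 2 =
    expR (2 * lam * (hexpect mu f - f x)).
  by rewrite expr2 -expRD; congr expR; ring.
have [v0|v0] := eqVneq v 0.
  exists b^-1, 0; split.
  - by rewrite invr_ge0 ltW.
  - under eq_integral do rewrite sqE.
    apply: (le_trans (@mgf_le_variance _ _ _ mu f b (2 * b^-1) 8 mf fb _ _)).
    + by rewrite mulr_ge0// invr_ge0 ltW.
    + move=> s; rewrite -mulrA mulVf ?gt_eqF// mulr1.
      exact: expR_le_bernstein2.
    + by rewrite -/v v0 !mulr0 addr0 expR0.
  - rewrite v0 mul0r sqrtr0 mulr0 add0r mulrA mulVf ?gt_eqF// mul1r addr0.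
    by [].
have {}v0 : 0 < v by rewrite lt_def v0 hvariance_ge0.
pose r := Num.sqrt (v / A).
have r0 : 0 < r by rewrite sqrtr_gt0 divr_gt0.
have r2 : r ^+ 2 = v / A by rewrite sqr_sqrtr// divr_ge0 ?ltW.
have br0 : 0 < b + r by rewrite addr_gt0.
have vAE : Num.sqrt (v * A) = r * A.
  have -> : v * A = (r * A) ^+ 2 by rewrite exprMn r2; field; rewrite gt_eqF.
  by rewrite sqrtr_sqr ger0_norm// mulr_ge0 ?ltW.
(* [sig] is half the variance term at [th = 2 / (b + r)], where the Bernstein coefficient is
   [(b + r) / (2 * r)]. As [v = r ^+ 2 * A], the last of the three conditions then holds with
   equality. *)
exists (b + r)^-1, (v / ((b + r) * r)); split.
- by rewrite invr_ge0 ltW.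
- under eq_integral do rewrite sqE.
  have tb2 : 2 - 2 * (b + r)^-1 * b = 2 * r / (b + r).
    by field; rewrite gt_eqF.
  apply: (le_trans (@mgf_le_variance _ _ _ mu f b (2 * (b + r)^-1)
    (2 - 2 * (b + r)^-1 * b)^-1 mf fb _ _)).
  + by rewrite mulr_ge0// invr_ge0 ltW.
  + move=> s st; rewrite (mulrC _ (s ^+ 2)); apply: expR_le_bernstein => //.
      by rewrite !mulr_ge0 ?invr_ge0 ?ltW.
    by rewrite -subr_gt0 tb2 divr_gt0// mulr_gt0.
  + rewrite lee_fin; apply: le_trans (expR_ge1Dx _).
    rewrite lerD2l tb2 -/v le_eqVlt; apply/orP; left; apply/eqP.
    by field; rewrite !gt_eqF.
- rewrite vAE; have -> : v = r ^+ 2 * A by rewrite r2; field; rewrite gt_eqF.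
  rewrite le_eqVlt; apply/orP; left; apply/eqP.
  by field; rewrite !gt_eqF.
Qed.

(** For the ratio [expR (2 * c)] and second moment [expR (2 * sig)], the one-coordinate constant is
    exactly [cosh c] times [expR sig]. *)
Lemma kantorovich_constant_le (c sig : R) :
  (1 + expR (2 * c)) / 2 * Num.sqrt (expR (2 * sig) / expR (2 * c)) <=
  expR (c ^+ 2 + sig).
Proof.
have -> : Num.sqrt (expR (2 * sig) / expR (2 * c)) = expR (- c) * expR sig.
  rewrite -expRN -expRD -expRD.
  have -> : 2 * sig + - (2 * c) = (- c + sig) + (- c + sig) by ring.
  by rewrite (expRD (- c + sig)) -expr2 sqrtr_sqr ger0_norm// expR_ge0.
have -> : (1 + expR (2 * c)) / 2 * (expR (- c) * expR sig) =
    (expR c + expR (- c)) / 2 * expR sig.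
  have -> : expR (2 * c) = expR c * expR c by rewrite -expRD; congr expR; ring.
  rewrite expRN; field; by rewrite gt_eqF// expR_gt0.
by rewrite expRD ler_pM2r ?expR_gt0// cosh_le_expR_sqr.
Qed.

Lemma gen_gap_sum n f (x : n.-tuple X) : (0 < n)%N ->
  n%:R * gen_gap mu f x = \sum_(i < n) (hexpect mu f - f (tnth x i)).
Proof.
move=> n0; rewrite sumrB sumr_const card_ord /gen_gap mulrBr mulVKf.
  by rewrite mulr_natl.
by rewrite pnatr_eq0 -lt0n.
Qed.

Lemma measurable_gen_gap n f : measurable_fun setT f ->
  measurable_fun setT (gen_gap mu f : n.-tuple X -> R).
Proof.
move=> mf; apply: measurable_funB => //; apply: measurable_funM => //.
apply: measurable_sum => i.
by apply: (measurableT_comp mf); exact: measurable_tnth.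
Qed.

(** Markov's inequality under the weight [W], where the [if] encodes the indicator of the bad event.
    [W] is not normalized: for fixed [h] the density is a function of the sample whose integral need
    not be 1. *)
Lemma gibbs_tail n f (W : n.-tuple X -> \bar R) (A b c delta : R) :
  (0 < n)%N -> measurable_fun setT f -> (forall x, 0 <= f x <= b) ->
  measurable_fun setT W -> (forall x, 0 <= W x)%E ->
  (forall i x y y', W (replace_at x i y) <=
    (expR (2 * c))%:E * W (replace_at x i y'))%E ->
  0 < delta -> delta < 1 ->
  A = c ^+ 2 + ln delta^-1 / n%:R ->
  (prod_integral mu (fun x => if (gen_gap mu f x <=
      2 * Num.sqrt (hvariance mu f * A) + b * A)%R then 0 else W x) <=
    delta%:E * prod_integral mu W)%E.
Proof.
move=> n0 mf fb mW W0 Wk d0 d1 AE; set B := _ + b * A.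
have nR : 0 < n%:R :> R by rewrite ltr0n.
have L0 : 0 < ln delta^-1 by rewrite ln_gt0// invf_gt1.
have A0 : 0 < A by rewrite AE ltr_wpDl ?sqr_ge0// divr_gt0.
have [x0 _] := probability_inhabited mu.
have b0 : 0 <= b by case/andP: (fb x0) => /le_trans; apply.
have dW0 : (0 <= delta%:E * prod_integral mu W)%E.
  by rewrite mule_ge0 ?prod_integral_ge0// lee_fin ltW.
(* If [b = 0] then [f] and its gap vanish and the bad event is empty; the choice of [lam] below
   requires [b > 0]. *)
move: b0; rewrite le_eqVlt => /predU1P[b0|b0].
  have f0 x : f x = 0 by apply/eqP; rewrite eq_le andbC {2}b0; exact: fb.
  have good (x : n.-tuple X) : gen_gap mu f x <= B.
    rewrite /gen_gap big1 ?mulr0 ?subr0; last by move=> i _; exact: f0.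
    rewrite (_ : f = cst 0) ?/hexpect; last by apply/funext.
    rewrite [leLHS](_ : _ = 0); last first.
      by rewrite /Rintegral /cst integral_probability_cst.
    by rewrite /B -b0 mul0r addr0 mulr_ge0// sqrtr_ge0.
  under [X in prod_integral _ X]eq_fun do rewrite good.
  by rewrite prod_integral_cst.
have [lam [sig [lam0 fS lamB]]] := bernstein_parameter mf fb b0 A0.
pose g x := expR (lam * (hexpect mu f - f x)).
have mg : measurable_fun setT g.
  apply: measurableT_comp => //; apply: measurable_funM => //.
  exact: measurable_funB.
have g0 x : 0 <= g x by exact: expR_ge0.
have prodE (x : n.-tuple X) :
    \prod_(i < n) g (tnth x i) = expR (lam * (n%:R * gen_gap mu f x)).
  by rewrite gen_gap_sum// mulr_sumr expR_sum.
have mP : measurable_fun setT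
    (fun x : n.-tuple X => (\prod_(i < n) g (tnth x i))%:E).
  apply/measurable_EFinP; apply: measurable_prod => i _.
  by apply: (measurableT_comp mg); exact: measurable_tnth.
have mPW := emeasurable_funM mP mW.
have P0 (x : n.-tuple X) : (0 <= (\prod_(i < n) g (tnth x i))%:E * W x)%E.
  by rewrite mule_ge0// lee_fin prodE expR_ge0.
(* On the bad event [E] times the product of the [g] is at least 1, which is the Markov step. *)
set E := expR (- (lam * (n%:R * B))).
apply: (@le_trans _ _ (E%:E *
    prod_integral mu (fun x => (\prod_(i < n) g (tnth x i))%:E * W x))%E).
  rewrite -prod_integralZl ?expR_ge0//.
  apply: le_prod_integral.
  - apply: measurable_fun_ifT => //; apply: measurable_fun_ler => //.
    exact: measurable_gen_gap.
  - exact: emeasurable_funM.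
  - by move=> x; case: ifP.
  - move=> x; case: ifPn => [_|]; first by rewrite mule_ge0// lee_fin expR_ge0.
    rewrite -ltNge => bad; rewrite muleA -EFinM prodE -expRD.
    rewrite -[leLHS]mul1e lee_wpmul2r// lee_fin -[leLHS]expR0 ler_expR.
    by rewrite addrC subr_ge0 ler_wpM2l// ler_wpM2l ?ltW.
apply: (@le_trans _ _ (E%:E * ((expR (c ^+ 2 + sig) ^+ n)%:E *
    prod_integral mu W))%E).
  rewrite lee_wpmul2l ?lee_fin ?expR_ge0//.
  apply: le_trans (prod_integral_mul_le_of_ratio mg g0 mW W0 (expR_gt0 _) Wk
    (expR_gt0 _) fS) _.
  rewrite lee_wpmul2r ?prod_integral_ge0// lee_fin.
  apply: lerXn2r; rewrite ?nnegrE ?expR_ge0//.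
  exact: kantorovich_constant_le.
rewrite muleA -EFinM lee_wpmul2r ?prod_integral_ge0// lee_fin.
rewrite -expRM_natl -expRD -[leRHS]lnK ?posrE// ler_expR.
(* [A] is calibrated for this identity; it reduces the goal to [A + sig <= lam * B]. *)
have -> : ln delta = n%:R * (c ^+ 2 - A).
  rewrite AE opprD addrA subrr add0r mulrN mulrC divfK ?gt_eqF//.
  by rewrite lnV ?posrE// opprK.
have -> : - (lam * (n%:R * B)) + n%:R * (c ^+ 2 + sig) =
  n%:R * (c ^+ 2 + sig - lam * B) by ring.
rewrite ler_pM2l//; move: lamB; rewrite -/B; lra.
Qed.

End gibbs_tail.

(** * Sigma-finiteness of the a-priori measure *)

(** The superlevel sets of [u] at the levels [- m%:R] exhaust the space, and each has finite measure
    by Markov's inequality for [expR (u h)]. *)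
Lemma sigma_finite_of_integrable_expR {d : measure_display}
    {T : measurableType d} {R : realType} (pi : {measure set T -> \bar R})
    (u : T -> R) :
  measurable_fun setT u -> (\int[pi]_h (expR (u h))%:E < +oo)%E ->
  sigma_finite setT pi.
Proof.
move=> um uoo.
pose F m := [set h | - m%:R <= u h].
exists F => [|m].
  apply/esym/seteqP; split => // h _.
  exists (Num.bound `|u h|) => //=; rewrite /F/= lerNl ltW//.
  by apply: le_lt_trans (archi_boundP (normr_ge0 _)); rewrite -normrN ler_norm.
have mF : measurable (F m).
  by rewrite -[X in measurable X]setTI /F -preimage_itvcy; exact: um.
split => //.
have mE : measurable_fun setT (fun h => (expR (u h))%:E).
  by apply/measurable_EFinP; exact: measurableT_comp.
have e0 := expR_gt0 (- m%:R : R).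
have : ((expR (- m%:R))%:E * pi (F m) < +oo)%E.
  apply: le_lt_trans uoo; rewrite -integral_cst//.
  apply: (@le_trans _ _ (\int[pi]_(h in F m) (expR (u h))%:E)%E).
    apply: ge0_le_integral => //.
    - by move=> h _; rewrite lee_fin ltW.
    - exact: measurable_funTS.
    - by move=> h uh; rewrite lee_fin ler_expR.
  by apply: ge0_subset_integral => // h _; rewrite lee_fin expR_ge0.
have := measure_ge0 pi (F m).
case: (pi (F m)) => [r _ _|_|//]; first exact: ltry.
by rewrite gt0_muley ?lte_fin.
Qed.

(** Bundles the property into the structure that Tonelli's theorem expects; the equality allows [pi]
    to be replaced in the goal. *)
Lemma sigma_finite_measure_exists {d : measure_display} {T : measurableType d}
    {R : realType} (pi : {measure set T -> \bar R}) :
  sigma_finite setT pi ->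
  exists nu : {sigma_finite_measure set T -> \bar R},
    (nu : {measure set T -> \bar R}) = pi.
Proof.
move=> sf.
pose m1 := isSFinite.Build _ _ _ _ (sfinite_measure_sigma_finite sf).
pose m2 := isSigmaFinite.Build _ _ _ _ sf.
pose nu := HB.pack_for {sigma_finite_measure set T -> \bar R}
  (Measure.sort pi) m1 m2.
by exists nu; exact: eq_measure.
Qed.

(** * The Gibbs density, and integration over the hypotheses *)

Section gibbs_algorithm.
Local Set Implicit Arguments.
Local Unset Strict Implicit.
Context {d dH : measure_display} {X : measurableType d}.
Context {Hs : measurableType dH} {R : realType}.
Variables (mu : probability X R) (pi : {sigma_finite_measure set Hs -> \bar R}).
Variable ev : Hs -> X -> R.
Hypothesis mev : measurable_fun setT (fun p : Hs * X => ev p.1 p.2).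
Hypothesis ev0 : forall h y, 0 <= ev h y.

Lemma measurable_hexpect (F : Hs -> X -> R) :
  measurable_fun setT (fun p : Hs * X => F p.1 p.2) ->
  (forall h y, 0 <= F h y) ->
  measurable_fun setT (fun h => hexpect mu (F h)).
Proof.
move=> mF F0; apply: (@measurableT_comp _ _ _ _ _ _ fine) => //.
have := @measurable_fun_fubini_tonelli_F _ _ _ _ R mu (fun p => (F p.1 p.2)%:E).
apply => [|p]; last by rewrite lee_fin.
exact/measurable_EFinP.
Qed.

Lemma measurable_hvariance :
  measurable_fun setT (fun h => hvariance mu (ev h)).
Proof.
apply: measurable_hexpect => [|h y]; last exact: sqr_ge0.
apply: measurable_funX; apply: measurable_funB => //.
apply: (@measurableT_comp _ _ _ _ _ _ (fun h => hexpect mu (ev h))) => //.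
exact: measurable_hexpect.
Qed.

Lemma measurable_sqrt : measurable_fun setT (@Num.sqrt R).
Proof. by apply: nondecreasing_measurable => // x y; exact: ler_wsqrtr. Qed.

Lemma measurable_gap_event n (A b : R) :
  measurable_fun setT (fun p : Hs * n.-tuple X => gen_gap mu (ev p.1) p.2 <=
    2 * Num.sqrt (hvariance mu (ev p.1) * A) + b * A).
Proof.
apply: measurable_fun_ler.
  apply: measurable_funB.
    apply: (@measurableT_comp _ _ _ _ _ _ (fun h => hexpect mu (ev h))) => //.
    exact: measurable_hexpect.
  apply: measurable_funM => //; apply: measurable_sum => i.
  have mp : measurable_fun setT
      (fun p : Hs * n.-tuple X => (p.1, tnth p.2 i)).
    apply: measurable_fun_pair => //.
    apply: (@measurableT_comp _ _ _ _ _ _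
      (fun x : n.-tuple X => tnth x i)) => //.
    exact: measurable_tnth.
  exact: (measurableT_comp mev mp).
apply: measurable_funD => //; apply: measurable_funM => //.
apply: (measurableT_comp measurable_sqrt); apply: measurable_funM => //.
apply: (@measurableT_comp _ _ _ _ _ _ (fun h => hvariance mu (ev h))) => //.
exact: measurable_hvariance.
Qed.

Variables (n : nat) (Ham : Hs -> n.-tuple X -> R).
Hypothesis mHam : measurable_fun setT (fun p : Hs * n.-tuple X => Ham p.1 p.2).
Hypothesis Zfin : forall x, (0 < partition_fun pi Ham x < +oo)%E.

Lemma fine_partition_fun_gt0 x : 0 < fine (partition_fun pi Ham x).
Proof. exact: fine_gt0. Qed.

Lemma fine_partition_funK x :
  (fine (partition_fun pi Ham x))%:E = partition_fun pi Ham x.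
Proof.
by rewrite fineK// ge0_fin_numE; case/andP: (Zfin x) => // /ltW.
Qed.

Lemma measurable_expR_Ham :
  measurable_fun setT (fun p : Hs * n.-tuple X => (expR (Ham p.1 p.2))%:E).
Proof. by apply/measurable_EFinP; exact: measurableT_comp. Qed.

Lemma measurable_Ham_section x : measurable_fun setT (Ham ^~ x).
Proof. exact: (measurableT_comp mHam (pair2_measurable x)). Qed.

Lemma measurable_partition_fun : measurable_fun setT (partition_fun pi Ham).
Proof.
have := measurable_fun_fubini_tonelli_G (m1 := pi) _ measurable_expR_Ham.
by apply => p; rewrite lee_fin expR_ge0.
Qed.

Lemma measurable_gibbs_density : measurable_fun setT
  (fun p : Hs * n.-tuple X => gibbs_density pi Ham p.2 p.1).
Proof.
apply/measurable_EFinP; apply: measurable_funM.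
  exact: measurableT_comp.
(* The inverse of [Z] is written as a real power, whose measurability is known; this is legitimate
   since [Z] is positive. *)
under eq_fun do rewrite -powR_inv1 ?(ltW (fine_partition_fun_gt0 _))//.
apply: (measurableT_comp (measurable_powR _)).
apply: (@measurableT_comp _ _ _ _ _ _ fine) => //.
apply: (@measurableT_comp _ _ _ _ _ _ (partition_fun pi Ham)) => //.
exact: measurable_partition_fun.
Qed.

Lemma gibbs_density_ge0 x h : (0 <= gibbs_density pi Ham x h)%E.
Proof.
by rewrite lee_fin divr_ge0 ?expR_ge0// ltW// fine_partition_fun_gt0.
Qed.

Lemma integral_gibbs_density x : (\int[pi]_h gibbs_density pi Ham x h = 1)%E.
Proof.
have Z0 := fine_partition_fun_gt0 x.
under eq_integral do rewrite /gibbs_density mulrC EFinM.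
rewrite ge0_integralZl_EFin//.
- rewrite -/(partition_fun pi Ham x) -fine_partition_funK -EFinM.
  by rewrite mulVf// gt_eqF.
- apply/measurable_EFinP; apply: measurableT_comp => //.
  exact: measurable_Ham_section.
- by rewrite invr_ge0 ltW.
Qed.

Variable c : R.
Hypothesis Hc : forall (k : 'I_n) h y y' x,
  Ham h (replace_at x k y) - Ham h (replace_at x k y') <= c.

(** One factor [expR c] comes from the numerator. The other comes from [Z], by integrating the same
    pointwise bound with [y] and [y'] exchanged. *)
Lemma gibbs_density_ratio h i x y y' :
  (gibbs_density pi Ham (replace_at x i y) h <=
   (expR (2 * c))%:E * gibbs_density pi Ham (replace_at x i y') h)%E.
Proof.
have ratio h0 z z' : expR (Ham h0 (replace_at x i z)) <=
    expR c * expR (Ham h0 (replace_at x i z')).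
  by rewrite -expRD ler_expR -lerBlDr.
set x1 := replace_at x i y; set x2 := replace_at x i y'.
have Z12 : fine (partition_fun pi Ham x2) <=
    expR c * fine (partition_fun pi Ham x1).
  rewrite -lee_fin EFinM !fine_partition_funK.
  have mE z : measurable_fun setT (fun h => (expR (Ham h z))%:E).
    apply/measurable_EFinP; apply: measurableT_comp => //.
    exact: measurable_Ham_section.
  rewrite /partition_fun -ge0_integralZl_EFin ?expR_ge0//.
  apply: ge0_le_integral => //.
  - exact: emeasurable_funM.
  - by move=> h0 _; rewrite -EFinM lee_fin; exact: ratio.
have Z1 := fine_partition_fun_gt0 x1.
have Z2 := fine_partition_fun_gt0 x2.
rewrite /gibbs_density -EFinM lee_fin mulrA ler_pdivrMr// mulrAC ler_pdivlMr//.
have -> : expR (2 * c) = expR c * expR c by rewrite -expRD; congr expR; ring.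
have -> : expR c * expR c * expR (Ham h x2) * fine (partition_fun pi Ham x1) =
    (expR c * expR (Ham h x2)) * (expR c * fine (partition_fun pi Ham x1)).
  by ring.
apply: ler_pM; rewrite ?expR_ge0 ?(ltW Z2)//; exact: ratio.
Qed.

(** The good part [G] and the bad part [B] of the density have total mass 1, so it suffices that [B]
    has mass at most [delta]. Tonelli puts the integral over [h] outside, where [gibbs_tail] applies
    for each [h]. *)
Lemma joint_prob_gap_ge (b delta A : R) : (0 < n)%N ->
  (forall h, measurable_fun setT (ev h)) ->
  (forall h y, 0 <= ev h y <= b) -> 0 < delta -> delta < 1 ->
  A = c ^+ 2 + ln delta^-1 / n%:R ->
  (1 - delta%:E <= joint_prob mu pi Ham (fun h x =>
     (gen_gap mu (ev h) x <=
       2 * Num.sqrt (hvariance mu (ev h) * A) + b * A)%R))%E.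
Proof.
move=> n0 mevh evb d0 d1 AE.
pose good h (x : n.-tuple X) := gen_gap mu (ev h) x <=
       2 * Num.sqrt (hvariance mu (ev h) * A) + b * A.
pose D (p : Hs * n.-tuple X) := gibbs_density pi Ham p.2 p.1.
pose G p := if good p.1 p.2 then D p else 0%E.
pose B p := if good p.1 p.2 then 0%E else D p.
have mD : measurable_fun setT D by exact: measurable_gibbs_density.
have mgood : measurable_fun setT (fun p => good p.1 p.2).
  exact: measurable_gap_event.
have mG : measurable_fun setT G by exact: measurable_fun_ifT.
have mB : measurable_fun setT B by exact: measurable_fun_ifT.
have D0 p : (0 <= D p)%E by exact: gibbs_density_ge0.
have G0 p : (0 <= G p)%E by rewrite /G; case: ifP.
have B0 p : (0 <= B p)%E by rewrite /B; case: ifP.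
have -> : joint_prob mu pi Ham (fun h x => good h x) =
    prod_integral mu (fun x => \int[pi]_h G (h, x))%E.
  rewrite /joint_prob; congr prod_integral; apply/funext => x.
  rewrite integral_mkcond; apply: eq_integral => h _.
  rewrite /patch /G /D /=; have [gd|/negP ngd] := boolP (good h x).
    by rewrite mem_set.
  by rewrite memNset.
have mGi : measurable_fun setT (fun x => \int[pi]_h G (h, x))%E.
  exact: (measurable_fun_fubini_tonelli_G (m1 := pi) _ mG G0).
have mBi : measurable_fun setT (fun x => \int[pi]_h B (h, x))%E.
  exact: (measurable_fun_fubini_tonelli_G (m1 := pi) _ mB B0).
have sec (F : Hs * n.-tuple X -> \bar R) x : measurable_fun setT F ->
    measurable_fun setT (fun h => F (h, x)).
  by move=> mF; exact: (measurableT_comp mF (pair2_measurable x)).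
have total : (prod_integral mu (fun x => \int[pi]_h G (h, x)) +
    prod_integral mu (fun x => \int[pi]_h B (h, x)) = 1)%E.
  rewrite -prod_integralD//.
  - rewrite -[RHS](prod_integral_cst mu n); congr prod_integral.
    apply/funext => x; rewrite -ge0_integralD//; [|exact: sec..].
    rewrite -[RHS](integral_gibbs_density x); apply: eq_integral => h _.
    by rewrite /G /B /=; case: ifP; rewrite ?adde0 ?add0e.
  - by move=> x; apply: integral_ge0.
  - by move=> x; apply: integral_ge0.
(* The sample integrals of the density, one for each [h], sum to 1 under [pi]; this turns the
   relative bounds of [gibbs_tail] into the absolute bound [delta]. *)
have PD : (\int[pi]_h prod_integral mu (fun x => D (h, x)) = 1)%E.
  rewrite -prod_integral_fubini// -[RHS](prod_integral_cst mu n).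
  congr prod_integral; apply/funext => x; exact: integral_gibbs_density.
have sec2 (F : Hs * n.-tuple X -> \bar R) h : measurable_fun setT F ->
    measurable_fun setT (fun x => F (h, x)).
  by move=> mF; exact: (measurableT_comp mF (pair1_measurable h)).
have badle : (prod_integral mu (fun x => \int[pi]_h B (h, x)) <= delta%:E)%E.
  rewrite prod_integral_fubini//.
  rewrite -[leRHS]mule1 -PD -ge0_integralZl_EFin//; last 3 first.
  - by move=> h _; exact: prod_integral_ge0.
  - exact: measurable_prod_integral.
  - exact: ltW.
  apply: ge0_le_integral => //.
  - by move=> h _; exact: prod_integral_ge0.
  - exact: measurable_prod_integral.
  - by apply: emeasurable_funM => //; exact: measurable_prod_integral.
  - move=> h _; apply: (@gibbs_tail _ _ _ mu n (ev h) _ A b c) => //.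
    + exact: (sec2 D h mD).
    + by move=> i x y y'; exact: gibbs_density_ratio.
by rewrite leeBlDr// -total leeD2l.
Qed.

End gibbs_algorithm.

Theorem theorem6
  (R : realType) (d : measure_display) (X : measurableType d)
  (mu : probability X R)
  (dH : measure_display) (Hs : measurableType dH)
  (ev : Hs -> X -> R)                       (* h |-> the function h : X -> R *)
  (pi : {measure set Hs -> \bar R})          (* a-priori measure *)
  (n : nat) (Ham : Hs -> n.-tuple X -> R)    (* Hamiltonian of Q *)
  (b c delta : R) :
  (0 < n)%N ->
  (* H is a measurable space of measurable functions (jointly measurable evaluation) *)
  (forall h, measurable_fun setT (ev h)) ->
  measurable_fun setT (fun p : Hs * X => ev p.1 p.2) ->
  (* Ham is a (measurable) Hamiltonian defining the algorithm Q:
     dQ_x = e^{H(.,x)} dpi / Z(x), with 0 < Z(x) < +oo *)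
  measurable_fun setT (fun p : Hs * n.-tuple X => Ham p.1 p.2) ->
  (forall x, (0 < partition_fun pi Ham x < +oo)%E) ->
  (* bounded differences of the Hamiltonian *)
  (forall (k : 'I_n) h y y' x,
      Ham h (replace_at x k y) - Ham h (replace_at x k y') <= c) ->
  (* h(y) in [0, b] *)
  (forall h y, 0 <= ev h y <= b) ->
  0 < delta ->
  (1 - delta%:E <=
   joint_prob mu pi Ham (fun h x =>
     (gen_gap mu (ev h) x <=
       2 * Num.sqrt (hvariance mu (ev h) * (c ^+ 2 + ln (delta^-1) / n%:R))
       + b * (c ^+ 2 + ln (delta^-1) / n%:R))%R))%E.
Proof.
move=> n0 mevh mev mHam Zfin Hc evb d0.
(* For [delta >= 1] the left-hand side is at most 0; below 1 the logarithm is positive, as the tail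
   bound requires. *)
have [d1|d1] := leP 1 delta.
  apply: (@le_trans _ _ 0%E); first by rewrite leeBlDr// add0e lee_fin.
  apply: prod_integral_ge0 => x; apply: integral_ge0 => h _.
  rewrite lee_fin divr_ge0 ?expR_ge0//; apply: fine_ge0.
  by case/andP: (Zfin x) => /ltW.
(* Finiteness of [Z] at a single sample, here a constant one, already makes [pi] sigma-finite. *)
have [y0 _] := probability_inhabited mu.
have sf : sigma_finite setT pi.
  apply: (@sigma_finite_of_integrable_expR _ _ _ _ (Ham ^~ (nseq_tuple n y0))).
    exact: (measurableT_comp mHam (pair2_measurable _)).
  by case/andP: (Zfin (nseq_tuple n y0)).
have [nu nuE] := sigma_finite_measure_exists _ sf.
rewrite -nuE in Zfin *.
have ev0 h y : 0 <= ev h y by case/andP: (evb h y).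
by apply: joint_prob_gap_ge.
Qed.
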